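(* Let $d\ge1$ and $n\ge2$ be integers. Then \begin{align*} \sum_{\lambda\in\mathcal{C}_{n,dn-1}}|\lambda| &= M_d(n)\Bigl(\frac{(d^2-1)(5d^2+d-1)n^2}{24d(4d+1)}-\frac{(d+1)(8d^4+27d^3+2d^2-1)n}{24d(4d+1)^2}+\frac{d^2-1}{12d}\Bigr)\\ &\quad+M_d(n-1)\Bigl(\frac{(d+1)(-d^3+7d^2+d-1)n^2}{24d(4d+1)}-\frac{(d+1)(6d^4-19d^3-7d^2+d+1)n}{24d(4d+1)^2}\\ &\qquad\qquad-\frac{(d+1)(d^4+20d^3-6d^2-8d-1)}{12d(4d+1)^2}\Bigr). \end{align*}
   Context: A partition $\lambda=(\lambda_1\ge\dots\ge\lambda_\ell)$ has size $|\lambda|=\sum_i\lambda_i$. The hook length of a box of its Young diagram is the number of boxes directly to its right, directly below it, plus the box itself. For a positive integer $t$, $\lambda$ is a $t$-core if none of its hook lengths is divisible by $t$; an $(s,t)$-core is both an $s$-core and a $t$-core. $\mathcal{C}_{n,dn-1}$ is the set of $(n,dn-1)$-core partitions with distinct parts. The sequence $M_d(n)$ is defined by $M_d(-1)=0$, $M_d(0)=1$, $M_d(n)=M_d(n-1)+dM_d(n-2)$ for $n\ge1$. *)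

(* Defs.v *)
From mathcomp Require Import all_boot all_order all_algebra.
From mathcomp Require Import boolp classical_sets functions cardinality fsbigop.

Set Implicit Arguments.
Unset Strict Implicit.
Unset Printing Implicit Defensive.

Definition is_partition (l : seq nat) : bool := sorted geq l && (0 \notin l).

(* Boxes are (row, column) pairs counted from 0, so row [i] of the Young diagram
   has columns [0 .. nth 0 l i - 1].  The summands are the box itself, the boxes
   to its right, and the boxes below it. *)
Definition hook_length (l : seq nat) (i j : nat) : nat :=
  1 + (nth 0 l i - j.+1) + count (fun r => j < r) (drop i.+1 l).

Definition is_core (t : nat) (l : seq nat) : bool :=
  [forall i : 'I_(size l), forall j : 'I_(nth 0 l i),
     ~~ (t %| hook_length l i j)].

Definition distinct_cores (s t : nat) : set (seq nat) :=
  [set l | [&& is_partition l, uniq l, is_core s l & is_core t l]]%classic.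

(* [M_shift d k] is M_d(k - 1), so that the initial value M_d(-1) = 0 is
   included. *)
Fixpoint M_shift (d k : nat) : nat :=
  match k with
  | 0 => 0
  | k'.+1 => match k' with
             | 0 => 1
             | k''.+1 => M_shift d k' + d * M_shift d k''
             end
  end.

Definition M (d n : nat) : nat := M_shift d n.+1.

(* Main.v *)
Require Import Defs.
From mathcomp Require Import all_boot all_order all_algebra.
From mathcomp Require Import boolp classical_sets functions cardinality fsbigop.
From mathcomp Require Import zify ring.

Set Implicit Arguments.
Unset Strict Implicit.
Unset Printing Implicit Defensive.

(* A partition with distinct parts is determined by its set B of first-column
   hook lengths, and distinctness means that B has no two consecutive elements.
   It is a t-core iff B is closed under subtracting t and does not contain 0.
   For a set B closed under subtracting n, let a_i be the number of elements
   congruent to i mod n.  The conditions for (n, dn-1) then say a_0 = 0, a_i <= d,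
   a_(n-1) < d, and no two adjacent a_i are nonzero.  The size of the partition is
   the sum of the i a_i + n C(a_i, 2) minus C(a_0 + ... + a_(n-1), 2).  Summing
   over all such sequences by removing the last entry gives recurrences
   f(k+2) = f(k+1) + d f(k) + ..., solved by polynomials in k times M_d(k) and
   M_d(k+1). *)

(** * Beta numbers of partitions with distinct parts *)

Fixpoint beta (l : seq nat) : seq nat :=
  if l is x :: l' then x + size l' :: beta l' else [::].

Fixpoint unbeta (bs : seq nat) : seq nat :=
  if bs is b :: bs' then b - size bs' :: unbeta bs' else [::].

Definition gap2 (b c : nat) : bool := c.+1 < b.

Definition closed_sub (t : nat) (bs : seq nat) : Prop :=
  forall b, b \in bs -> t <= b -> b - t \in bs.

Lemma size_beta l : size (beta l) = size l.
Proof. by elim: l => //= x l ->. Qed.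

Lemma size_unbeta bs : size (unbeta bs) = size bs.
Proof. by elim: bs => //= b bs ->. Qed.

Lemma betaK : cancel beta unbeta.
Proof. by elim=> //= x l ->; rewrite size_beta addnK. Qed.

Lemma sumn_beta l : sumn (beta l) = sumn l + 'C(size l, 2).
Proof. by elim: l => //= x l ->; rewrite binS bin1; lia. Qed.

Lemma gap2_trans : transitive gap2.
Proof. by move=> y x z; rewrite /gap2; lia. Qed.

(** Consecutive beta numbers differ by one more than the corresponding parts, so a strict descent
    becomes a gap of at least 2. *)
Lemma sorted_gtn_beta l : sorted gtn l = sorted gap2 (beta l).
Proof.
elim: l => //= x [//|y l] /= ->; congr (_ && _).
by rewrite /gap2; lia.
Qed.

Lemma gap2_size b bs : sorted gap2 (b :: bs) -> size bs <= b.
Proof. by elim: bs b => //= c bs IH b /andP[bc /IH]; rewrite /gap2 in bc; lia. Qed.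

(** By [gap2_size] the truncated subtractions in [unbeta] lose nothing. *)
Lemma unbetaK bs : sorted gap2 bs -> beta (unbeta bs) = bs.
Proof.
elim: bs => //= b bs IH bbs.
rewrite size_unbeta IH ?(path_sorted bbs) // subnK //.
exact: gap2_size bbs.
Qed.

Lemma beta_le l c y : path geq y l -> c \in beta l -> c < y + size l.
Proof.
elim: l c y => //= x l IH c y /andP[/= xy xl].
by rewrite inE => /orP[/eqP->|/(IH _ _ xl)]; lia.
Qed.

Lemma count_path_geq y l j : path geq y l -> y <= j ->
  count (fun r => j < r) l = 0.
Proof.
elim: l y => //= x l IH y /andP[/= xy xl] yj.
rewrite (IH x) //; lia.
Qed.

Lemma mem_beta0 l : sorted gtn l -> (0 \in beta l) = (0 \in l).
Proof.
elim: l => //= x l IH xl; rewrite !inE IH ?(path_sorted xl) //.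
case: l xl {IH} => [|y l] /=; first by rewrite addn0.
by move=> /andP[/= yx _]; congr (_ || _); lia.
Qed.

(* The hooks of the first row are the differences between the first beta number
   and the smaller non-members of the beta set. *)
Lemma hook_gap x l : path geq x l -> forall c,
  reflect (exists2 j, j < x & c = j + (size l - count (fun r => j < r) l))
          ((c < x + size l) && (c \notin beta l)).
Proof.
elim: l x => [|y l IH] x /=.
  move=> _ c; rewrite addn0 andbT; apply: (iffP idP) => [cx|[j jx ->]].
    by exists c; rewrite ?addn0 ?subn0.
  by rewrite addn0.
move=> /andP[/= yx yl] c; have cl j := count_size (fun r => j < r) l.
apply: (iffP andP) => [[cx]|[j jx ->]].
  rewrite inE negb_or => /andP[cy cl'].
  have [cly|cgy] := ltnP c (y + size l).
    have [|j jy ->] := IH _ yl c _; first by rewrite cly.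
    by exists j; [lia | rewrite jy; have := cl j; lia].
  (* Here [c] exceeds every element of [beta (y :: l)], so this column is at least [y] and no lower
     row reaches it. *)
  exists (c - (size l).+1); first by lia.
  rewrite (count_path_geq yl); lia.
have [yj|jy] := leqP y j.
  rewrite (count_path_geq yl) // addn0; split; first lia.
  rewrite inE negb_or; apply/andP; split; first by lia.
  by apply/negP => /(beta_le yl); lia.
have /andP[h1 h2] := introT (IH _ yl _) (ex_intro2 _ _ j jy erefl).
have -> : (size l).+1 - (1 + count (fun r => j < r) l) =
  size l - count (fun r => j < r) l by lia.
by rewrite inE negb_or h2 andbT; split; lia.
Qed.

(** * The core condition on beta sets *)

Lemma is_coreP t l :
  reflect (forall i j, i < size l -> j < nth 0 l i -> ~~ (t %| hook_length l i j))
          (is_core t l).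
Proof.
apply: (iffP forallP) => [h i j il jl|h i]; last by apply/forallP => j; apply: h.
by have /forallP/(_ (Ordinal jl)) := h (Ordinal il).
Qed.

(** By [hook_gap], the hooks of the row with beta number [b] are the differences [b - c] with
    [c < b] outside the beta set. Induction strips the first row, which leaves the hooks of the
    other rows unchanged. *)
Lemma is_core_beta t l : sorted geq l ->
  is_core t l <->
  (forall b c, b \in beta l -> c < b -> t %| b - c -> c \in beta l).
Proof.
elim: l => [|x l IH] xl; first by split=> // _; apply/is_coreP.
have {}IH := IH (path_sorted xl).
have cl j := count_size (fun r => j < r) l.
have hookE j : j < x -> hook_length (x :: l) 0 j =
    x + size l - (j + (size l - count (fun r => j < r) l)).
  by move=> jx; rewrite /hook_length /= drop0; have := cl j; lia.
split=> [/is_coreP core b c|closed].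
  rewrite /= inE => /orP[/eqP->{b}|bl] cb tbc; rewrite inE.
    apply: contraT; rewrite negb_or => /andP[_ cl'].
    have /(hook_gap xl)[j jx jE] : (c < x + size l) && (c \notin beta l).
      by rewrite cb.
    by have := core 0 j isT jx; rewrite hookE // -jE tbc.
  have core' : is_core t l by apply/is_coreP => i j; apply: (core i.+1 j).
  by rewrite (iffLR IH core' _ _ bl cb tbc) orbT.
apply/is_coreP => -[|i] j /= il jl.
  rewrite hookE //; apply/negP => tx.
  have /andP[h1 h2] := introT (hook_gap xl _) (ex_intro2 _ _ j jl erefl).
  have := closed _ _ (mem_head _ _) h1 tx.
  by rewrite inE (negPf h2) orbF ltn_eqF.
have /is_coreP : is_core t l; last by apply.
apply/IH => b c bl cb tbc.
have := closed b c; rewrite /= !inE bl orbT => /(_ isT cb tbc).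
(* As [c] lies below an element of [beta l], it cannot be the new first beta number. *)
by rewrite (ltn_eqF (ltn_trans cb (beta_le xl bl))).
Qed.

Lemma is_core_closed_sub t l : 0 < t -> sorted geq l -> 0 \notin beta l ->
  is_core t l <-> closed_sub t (beta l).
Proof.
move=> t0 sl l0; rewrite is_core_beta //; split=> closed.
  move=> b bl tb; apply: (closed _ _ bl); first by lia.
  by rewrite subKn.
move=> b c bl cb /dvdnP[k]; elim: k b bl cb => [|k IH] b bl cb bc; first by lia.
have tb : t <= b by rewrite mulSn in bc; lia.
have bt := closed _ bl tb.
have [cE|cb'] := eqVneq c (b - t); first by rewrite cE.
by apply: (IH _ bt); rewrite mulSn in bc; lia.
Qed.

Lemma distinct_coresE n m l : 0 < n -> 0 < m ->
  distinct_cores n m l <->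
  [/\ sorted gap2 (beta l), 0 \notin beta l,
      closed_sub n (beta l) & closed_sub m (beta l)].
Proof.
move=> n0 m0; rewrite /distinct_cores /=.
split=> [/and4P[/andP[sl l0] ul cn cm]|[bl b0 cn cm]].
  have gl : sorted gtn l by rewrite gtn_sorted_uniq_geq ul.
  by split; rewrite -?sorted_gtn_beta ?mem_beta0 //; apply/is_core_closed_sub;
    rewrite ?mem_beta0.
have gl : sorted gtn l by rewrite sorted_gtn_beta.
have := gl; rewrite gtn_sorted_uniq_geq => /andP[ul sl].
by rewrite /is_partition sl ul -mem_beta0 // b0 /=; apply/andP; split;
  apply/is_core_closed_sub.
Qed.

(** * Runners of the abacus modulo [n] *)

Lemma gap2_gtn bs : sorted gap2 bs -> sorted gtn bs.
Proof. by apply: sub_sorted => x y; rewrite /gap2 /=; lia. Qed.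

Lemma gap2_succ bs b : sorted gap2 bs -> b \in bs -> b.+1 \notin bs.
Proof.
elim: bs => //= c bs IH; rewrite (path_sortedE gap2_trans) => /andP[/allP cbs sbs].
rewrite !inE negb_or => /orP[/eqP->|bbs]; last first.
  by rewrite IH // andbT; have := cbs _ bbs; rewrite /gap2; lia.
by apply/andP; split; [lia | apply/negP => /cbs; rewrite /gap2; lia].
Qed.

Lemma gtn_gap2 bs : sorted gtn bs ->
  (forall b, b \in bs -> b.+1 \notin bs) -> sorted gap2 bs.
Proof.
move=> sbs succ; apply/(sortedP 0) => i ibs.
have /= lt_i := sortedP 0 sbs i ibs.
have si := succ _ (mem_nth 0 ibs).
rewrite /gap2 ltn_neqAle lt_i andbT; apply: contraNneq si => ->.
exact: mem_nth (ltnW ibs).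
Qed.

(* A code lists the bead counts from residue [size a - 1] down to residue [0]. *)
Fixpoint runners (n : nat) (a : seq nat) : seq nat :=
  if a is v :: a' then [seq k * n + size a' | k <- iota 0 v] ++ runners n a'
  else [::].

Fixpoint weight (n : nat) (a : seq nat) : nat :=
  if a is v :: a' then v * size a' + n * 'C(v, 2) + weight n a' else 0.

Lemma sumn_runners n a : sumn (runners n a) = weight n a.
Proof.
elim: a => //= v a IH; rewrite sumn_cat IH; congr (_ + _).
elim: v => [|v IHv]; first by rewrite bin0n muln0.
by rewrite -addn1 iotaD map_cat sumn_cat IHv /= addn1 binS bin1; lia.
Qed.

Lemma size_runners n a : size (runners n a) = sumn a.
Proof. by elim: a => //= v a IH; rewrite size_cat size_map size_iota IH. Qed.

(** Reversing the code makes the index the residue: [b] sits at level [b %/ n] of runner [b %% n].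
    Residues beyond the length of the code get the default 0, an empty runner. *)
Lemma mem_runners n a b : 0 < n -> size a <= n ->
  (b \in runners n a) = (b %/ n < nth 0 (rev a) (b %% n)).
Proof.
move=> n0; elim: a => [|v a IH] /= an; first by rewrite nth_nil.
rewrite mem_cat IH; last exact: ltnW.
rewrite rev_cons nth_rcons size_rev.
have -> : (b \in [seq k * n + size a | k <- iota 0 v]) =
    (b %% n == size a) && (b %/ n < v).
  apply/mapP/andP => [[k]|[/eqP bn bv]]; last first.
    by exists (b %/ n); rewrite ?mem_iota // -bn -divn_eq.
  by rewrite mem_iota => kv ->; rewrite divnMDl // modnMDl modn_small // divn_small // addn0.
case: (ltngtP (b %% n) (size a)) => //= [ba|->]; first by rewrite nth_default ?size_rev // ltnW.
by rewrite nth_default ?size_rev // orbF.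
Qed.

Lemma uniq_runners n a : 0 < n -> size a <= n -> uniq (runners n a).
Proof.
move=> n0; elim: a => //= v a IH an.
rewrite cat_uniq IH ?(ltnW an) // andbT; apply/andP; split.
  rewrite map_inj_uniq ?iota_uniq // => x y /addIn /eqP.
  by rewrite eqn_pmul2r // => /eqP.
apply/hasPn => b; rewrite mem_runners // ?(ltnW an) //.
move=> h; apply/mapP => -[k _ bE]; move: h.
by rewrite bE modnMDl modn_small // nth_default // size_rev.
Qed.

(** * Enumeration of the codes *)

(* The trailing entry [0] makes the number of codes of length [k] equal to M_d(k). *)
Fixpoint codes (d k : nat) : seq (seq nat) :=
  match k with
  | 0 => [:: [::]]
  | k'.+1 => match k' with
             | 0 => [:: [:: 0]]
             | k''.+1 => map (cons 0) (codes d k') ++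
                 [seq v :: 0 :: a | v <- iota 1 d, a <- codes d k'']
             end
  end.

Definition is_code (d : nat) (a : seq nat) : bool :=
  [&& all (leq^~ d) a, sorted (fun x y => (x == 0) || (y == 0)) a & last 0 a == 0].

Lemma codesSS d k : codes d k.+2 = map (cons 0) (codes d k.+1) ++
                 [seq v :: 0 :: a | v <- iota 1 d, a <- codes d k].
Proof. by []. Qed.

Lemma nat_ind2 (P : nat -> Prop) : P 0 -> P 1 ->
  (forall k, P k -> P k.+1 -> P k.+2) -> forall k, P k.
Proof.
by move=> P0 P1 PSS k; suff [] : P k /\ P k.+1; elim: k => // k [] ? ?; split; auto.
Qed.

Lemma mem_codes d k a : (a \in codes d k) = (size a == k) && is_code d a.
Proof.
elim/nat_ind2: k a => [||k IH0 IH1] a.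
- by rewrite /= inE; case: a.
- case: a => [//|x [|y a]]; rewrite //= inE /is_code /= ?andbT //.
    by rewrite eqseq_cons andbT; case: x => [|x]; rewrite ?andbF.
  by rewrite eqseq_cons andbF.
rewrite codesSS mem_cat; apply/orP/andP.
  case=> [/mapP[b]|/allpairsP[[v b] /= []]].
    rewrite IH1 => /andP[/eqP sb /and3P[h1 h2 h3]] ->.
    rewrite /= sb eqxx; split=> //; apply/and3P; split=> //=.
      by case: (b) h2.
  rewrite mem_iota IH0 => vd /andP[/eqP sb /and3P[h1 h2 h3]] ->.
  rewrite /= sb eqxx; split=> //; apply/and3P; split=> //=.
  - by rewrite h1 andbT; lia.
  - by rewrite orbT /=; case: b {sb h1 h3} h2.
case: a => [|x [|w a]] [] // /eqP[sa] /and3P[/and3P[h0 h0' h1]] /andP[h hs] h3.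
(* A nonzero first entry forces the second to be 0, which selects the second branch of the
   recursion. *)
case: x h3 h0 h => [h3 _ _|v h3 h0 /= /eqP w0].
  by left; apply: map_f; rewrite IH1 /= sa eqxx; apply/and3P; split=> //; apply/andP.
right; subst w; apply/allpairsP; exists (v.+1, a); split=> //=; first by rewrite mem_iota; lia.
rewrite IH0 sa eqxx; apply/and3P; split=> //.
by apply/andP; split=> //; exact: path_sorted hs.
Qed.

Lemma codes_uniq d k : uniq (codes d k).
Proof.
elim/nat_ind2: k => // k IH0 IH1; rewrite codesSS cat_uniq; apply/and3P; split.
- by rewrite map_inj_uniq // => x y [].
- apply/hasPn => _ /allpairsP[[v a] /= [+ _ ->]].
  by rewrite mem_iota => v1; apply/mapP => -[b _ [v0]]; rewrite v0 in v1.
by apply: allpairs_uniq => //; [exact: iota_uniq | move=> [v a] [w b] _ _ [-> ->]].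
Qed.

(** Restates the conditions by residue: the last entry is runner 0 and the head is runner [n.-1],
    the one containing dn-1 at level d-1. *)
Lemma is_codeP d n a : 0 < d -> 0 < n -> size a = n ->
  let f := nth 0 (rev a) in
  reflect [/\ forall i, f i <= d, forall i, f i = 0 \/ f i.+1 = 0, f 0 = 0
            & f n.-1 < d]
          (is_code d a && (head 0 a < d)).
Proof.
move=> d0 n0 an f.
have hd : head 0 a = f n.-1.
  by rewrite /f nth_rev an ?prednK ?subnn ?nth0 //.
have la : last 0 a = f 0.
  by rewrite /f nth_rev an // subn1 -an nth_last.
rewrite /is_code hd la -all_rev.
have -> : sorted (fun x y => (x == 0) || (y == 0)) a =
    sorted (fun x y => (x == 0) || (y == 0)) (rev a).
  by rewrite rev_sorted; apply: eq_sorted => x y; rewrite orbC.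
apply: (iffP andP) => [[/and3P[/(all_nthP 0) h1 /(sortedP 0) h2 /eqP h3] h4]|].
  split=> // i.
    by have [ia|ia] := ltnP i (size (rev a)); [exact: h1 | rewrite /f nth_default].
  have [ia|ia] := ltnP i.+1 (size (rev a)); last by right; rewrite /f nth_default.
  by case/orP: (h2 _ ia) => /eqP; [left|right].
case=> h1 h2 h3 h4; split=> //; apply/and3P; split; last by rewrite h3.
  by apply/(all_nthP 0) => i _; apply: h1.
by apply/(sortedP 0) => i _; rewrite -/f; case: (h2 i) => ->; rewrite eqxx ?orbT.
Qed.

(** * Bijection between codes and cores *)

Definition code_core (n : nat) (a : seq nat) : seq nat :=
  unbeta (sort geq (runners n a)).

Definition core_codes (d n : nat) : seq (seq nat) :=
  [seq a <- codes d n | head 0 a < d].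

Lemma sorted_sort_runners n a : 0 < n -> size a <= n ->
  sorted gtn (sort geq (runners n a)).
Proof.
move=> n0 an; rewrite gtn_sorted_uniq_geq sort_uniq uniq_runners //.
by apply: sort_sorted => x y; exact: leq_total.
Qed.

Lemma core_codesP d n a : 0 < d -> 0 < n -> a \in core_codes d n ->
  let bs := sort geq (runners n a) in
  [/\ size a = n, sorted gap2 bs, 0 \notin bs, closed_sub n bs
    & closed_sub (d * n - 1) bs].
Proof.
move=> d0 n0; rewrite mem_filter mem_codes => /and3P[hd /eqP an code] bs.
have /(is_codeP d0 n0 an)[] : is_code d a && (head 0 a < d) by rewrite code.
set f := nth 0 (rev a) => f_le f_adj f0 f_last.
have bsE b : (b \in bs) = (b %/ n < f (b %% n)).
  by rewrite mem_sort mem_runners // an.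
split=> //.
- apply: gtn_gap2; first by apply: sorted_sort_runners; rewrite ?an.
  move=> b; rewrite !bsE => hb; apply/negP; rewrite divnS // modnS.
  (* Either the residue of [b.+1] wraps around to the empty runner 0, or [b] and [b.+1] are on
     adjacent runners, one of which is empty. *)
  case: ifP => _ hb'; first by rewrite f0 in hb'.
  by case: (f_adj (b %% n)) => fE; rewrite fE in hb hb'.
- by rewrite bsE mod0n f0.
- move=> b; rewrite !bsE => hb nb.
  have -> : (b - n) %% n = b %% n by rewrite -(modnDr (b - n)) subnK.
  by apply: leq_ltn_trans hb; apply: leq_div2r; lia.
move=> b; rewrite bsE => hb /=; rewrite leq_subLR => dnb.
have := f_le (b %% n); have := ltn_pmod b n0; have := divn_eq b n.
(* All levels are below [d], so the only candidate [b] is dn-1 itself, at level d-1 of runner n-1;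
   [f_last] excludes it. *)
have [bd|bd] := leqP d (b %/ n); first by lia.
move: (b %/ n) (b %% n) hb bd => q r hb qd bE rn fr; rewrite bE in dnb.
have qE : q = d.-1.
  apply/eqP; rewrite eqn_leq; apply/andP; split; first lia.
  rewrite -ltnS prednK //; apply: contraT; rewrite -ltnNge => qd'.
  have : d * n >= q.+2 * n by rewrite leq_mul2r qd' orbT.
  nia.
have rE : r = n.-1 by subst q; nia.
by subst; lia.
Qed.
Lemma closed_sub_iter t bs b k : closed_sub t bs -> b \in bs -> k * t <= b ->
  b - k * t \in bs.
Proof.
move=> closed bbs; elim: k => [|k IH] kb; first by rewrite subn0.
by rewrite mulSnr subnDA; apply: closed; [apply: IH|]; rewrite mulSnr in kb; lia.
Qed.

(** A downward closed predicate holds on an initial segment, and the count is the length of that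
    segment within [iota 0 d]. *)
Lemma count_initial (P : pred nat) d : (forall i j, P i -> j <= i -> P j) ->
  forall k, (k < count P (iota 0 d)) = (k < d) && P k.
Proof.
move=> down k; elim: d => // d IH.
rewrite -[d.+1]addn1 iotaD count_cat /= addn0 add0n addn1.
have := count_size P (iota 0 d); rewrite size_iota.
have [Pd|nPd] := boolP (P d).
  have /eqP -> : count P (iota 0 d) == d.
    rewrite -[X in _ == X](size_iota 0 d) -all_count; apply/allP => i.
    by rewrite mem_iota => /andP[_ id]; apply: (down d) => //; apply: ltnW.
  rewrite addn1 ltnS => _; case: leqP => //= kd; first by rewrite (down d).
rewrite addn0 IH => _.
have [->|kd] := eqVneq k d; first by rewrite (negPf nPd) !andbF.
by congr (_ && _); lia.
Qed.

Lemma core_codes_complete d n bs : 0 < d -> 1 < n -> sorted gap2 bs ->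
  0 \notin bs -> closed_sub n bs -> closed_sub (d * n - 1) bs ->
  exists2 a, a \in core_codes d n & sort geq (runners n a) = bs.
Proof.
move=> d0 n1 sbs bs0 cn cdn; have n0 := ltnW n1.
have down b k : b \in bs -> k <= b %/ n -> k * n + b %% n \in bs.
  move=> bbs kb; have := closed_sub_iter (k := b %/ n - k) cn bbs.
  have -> : b - (b %/ n - k) * n = k * n + b %% n.
    by rewrite {1}(divn_eq b n) mulnBl addnC subnBA ?leq_mul2r ?kb ?orbT //; nia.
  by apply; rewrite (leq_trans _ (leq_trunc_div b n)) // leq_mul2r leq_subr orbT.
have res0 b : b \in bs -> b %% n != 0.
  by move=> bbs; apply/negP => /eqP bn; have := down _ 0 bbs isT; rewrite bn (negPf bs0).
(* If [b] had level at least [d] and residue r, then b-(dn-1) would have residue r+1. Sliding both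
   down to level 0 puts r and r+1 in [bs], against the gaps, or 0 in [bs] when r+1 = n. *)
have low b : b \in bs -> b %/ n < d.
  move=> bbs; rewrite ltnNge; apply/negP => db.
  have bE := divn_eq b n.
  have dnb : d * n <= b %/ n * n by rewrite leq_mul2r db orbT.
  have := cdn _ bbs; have -> : b - (d * n - 1) = (b %/ n - d) * n + (b %% n).+1.
    by rewrite mulnBl {1}bE; nia.
  move=> /(_ ltac:(lia)) b'bs; have := res0 _ b'bs.
  have := down _ 0 bbs isT; have := down _ 0 b'bs isT.
  rewrite !mul0n !add0n modnMDl.
  have := ltn_pmod b n0; rewrite leq_eqVlt => /orP[/eqP ->|bn]; first by rewrite modnn.
  by rewrite modn_small // => h1 /(gap2_succ sbs); rewrite h1.
(* By [low], levels below [d] account for all elements of residue [i]. *)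
pose f i := count (fun k => k * n + i \in bs) (iota 0 d).
pose a := rev (mkseq f n).
have an : size a = n by rewrite size_rev size_mkseq.
have fE i k : i < n -> (k < f i) = (k * n + i \in bs).
  move=> ilt; rewrite /f count_initial; last first.
    move=> k1 k2 kbs k12; have := down _ k2 kbs.
    by rewrite divnMDl // divn_small // addn0 modnMDl modn_small //; apply.
  rewrite andbC; case: (boolP (_ \in bs)) => //= kbs.
  by have := low _ kbs; rewrite divnMDl // divn_small // addn0.
have ra i : nth 0 (rev a) i = if i < n then f i else 0.
  rewrite revK; case: ltnP => ilt; first by rewrite nth_mkseq.
  by rewrite nth_default ?size_mkseq.
exists a; last first.
  apply: (irr_sorted_eq (leT := gtn)).
  - by move=> y x z /= ? ?; lia.
  - by move=> x /=; rewrite ltnn.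
  - by apply: sorted_sort_runners; rewrite ?an.
  - exact: gap2_gtn.
  move=> b; rewrite mem_sort mem_runners ?an // ra ltn_pmod // fE ?ltn_pmod //.
  by rewrite -divn_eq.
rewrite mem_filter mem_codes an eqxx andbC.
apply/(is_codeP d0 n0 an); split=> [i|i||]; rewrite ?ra.
- by case: ifP => // _; rewrite -[leqRHS](size_iota 0 d) count_size.
- have [in1|_] := ltnP i.+1 n; last by right.
  rewrite (ltnW in1).
  case: (posnP (f i)) => [->|]; first by left.
  case: (posnP (f i.+1)) => [->|]; first by right.
  by rewrite !fE ?(ltnW in1) // !mul0n !add0n => h /(gap2_succ sbs); rewrite h.
- by rewrite n0; apply/eqP; rewrite -leqn0 leqNgt fE // (negPf bs0).
(* With [d] beads, the last runner would contain dn-1, and subtracting dn-1 would put 0 in [bs]. *)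
rewrite prednK // leqnn ltnNge; apply/negP => df.
have : d.-1 < f n.-1 by rewrite prednK.
rewrite fE; last by rewrite prednK.
have -> : d.-1 * n + n.-1 = d * n - 1 by case: (d) d0 (n) n0 => [//|d'] _ [//|n'] _; nia.
by move=> h; have := cdn _ h (leqnn _); rewrite subnn (negPf bs0).
Qed.

Lemma distinct_cores_codes d n : 0 < d -> 1 < n ->
  distinct_cores n (d * n - 1) =
    [set` [seq code_core n a | a <- core_codes d n]]%classic.
Proof.
move=> d0 n1; have n0 := ltnW n1.
have m0 : 0 < d * n - 1 by nia.
apply/seteqP; split=> l /=.
  move=> /(distinct_coresE _ n0 m0)[sl l0 cn cm].
  have [a ain aE] := core_codes_complete d0 n1 sl l0 cn cm.
  by apply/mapP; exists a; rewrite // /code_core aE betaK.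
move=> /mapP[a /(core_codesP d0 n0)[an sa a0 cn cm] ->].
by apply/(distinct_coresE _ n0 m0); rewrite /code_core unbetaK.
Qed.

Lemma core_codes_uniq d n : 0 < d -> 0 < n ->
  uniq [seq code_core n a | a <- core_codes d n].
Proof.
move=> d0 n0; rewrite map_inj_in_uniq; first by rewrite filter_uniq ?codes_uniq.
move=> a b /(core_codesP d0 n0)[an sa _ _ _] /(core_codesP d0 n0)[bn sb _ _ _].
move/(congr1 beta); rewrite !unbetaK // => ab.
apply: (can_inj revK); apply: (@eq_from_nth _ 0); first by rewrite !size_rev an.
move=> i; rewrite size_rev an => ilt.
(* Each entry is recovered from the [k] below it, that is, from membership of [k * n + i] in the
   common beta set. *)
have E k : (k < nth 0 (rev a) i) = (k < nth 0 (rev b) i).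
  have := congr1 (fun s => k * n + i \in s) ab; rewrite !mem_sort !mem_runners ?an ?bn //.
  by rewrite divnMDl // divn_small // addn0 modnMDl modn_small.
apply/eqP; rewrite eqn_leq leqNgt E -leqNgt leqnn /=.
by rewrite leqNgt -E -leqNgt.
Qed.

(** The beta numbers add up to [weight n a], and there are [sumn a] of them; [sumn_beta] then gives
    the size of the partition. *)
Lemma sumn_code_core d n a : 0 < d -> 0 < n -> a \in core_codes d n ->
  sumn (code_core n a) + 'C(sumn a, 2) = weight n a.
Proof.
move=> d0 n0 /(core_codesP d0 n0)[an sa _ _ _].
rewrite /code_core -(size_runners n a) -(size_sort geq) -size_unbeta -sumn_beta.
rewrite unbetaK // -sumn_runners.
by apply: perm_sumn; rewrite perm_sort.
Qed.

(** * Recurrences and closed forms for sums over codes *)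

Import GRing.Theory.
Local Open Scope ring_scope.

Lemma natr_bin2 (m : nat) : 'C(m, 2)%:R = m%:R * (m%:R - 1) / 2 :> rat.
Proof.
elim: m => [|m IH]; first by rewrite bin0n !mul0r.
by rewrite binS bin1 natrD IH -natr1; field.
Qed.

Lemma sum_codesSS (P : pred (seq nat)) d k (F : seq nat -> rat) :
  \sum_(a <- codes d k.+2 | P a) F a =
    \sum_(a <- codes d k.+1 | P (0%N :: a)) F (0%N :: a) +
    \sum_(v <- iota 1 d) \sum_(a <- codes d k | P [:: v, 0%N & a]) F [:: v, 0%N & a].
Proof.
rewrite codesSS big_cat big_map; congr (_ + _).
by rewrite big_mkcond big_allpairs_dep; apply: eq_bigr => v _; rewrite -big_mkcond.
Qed.

(** The modulus [n] is not tied to the length of [a], so it stays fixed in recurrences on the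
    length. *)
Definition core_size (n : nat) (a : seq nat) : rat :=
  (weight n a)%:R - 'C(sumn a, 2)%:R.

Lemma core_size0 n a : core_size n (0%N :: a) = core_size n a.
Proof. by rewrite /core_size /= muln0. Qed.

(** Since 'C(v + s, 2) = 'C(v, 2) + 'C(s, 2) + v s, one 'C(v, 2) cancels, which turns [n] into n-1,
    and the cross term remains. *)
Lemma core_size_cons n v a : core_size n [:: v, 0%N & a] =
  core_size n a + v%:R * (size a).+1%:R + (n%:R - 1) * (v%:R * (v%:R - 1) / 2)
    - v%:R * (sumn a)%:R.
Proof.
rewrite /core_size /= !natr_bin2 ?add0n ?bin0n ?muln0 ?mul0n !natrD !natrM natr_bin2.
by field.
Qed.

Lemma sum_codes1 d k : \sum_(a <- codes d k) 1 = (M d k)%:R :> rat.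
Proof.
elim/nat_ind2: k => [||k IH0 IH1]; [by rewrite /= big_seq1 /M /= ?muln0..|].
rewrite (sum_codesSS xpredT d k (fun=> 1)) IH1 IH0 big_const_seq count_predT size_iota.
by rewrite iter_addr_0 -mulrnA mulnC -natrD.
Qed.

Lemma M_SS d k : (M d k.+2)%:R = (M d k.+1)%:R + d%:R * (M d k)%:R :> rat.
Proof. by rewrite -natrM -natrD. Qed.

Lemma iota1S m : iota 1 m.+1 = rcons (iota 1 m) m.+1.
Proof. by rewrite -[m.+1]addn1 iotaD cats1 add1n addn1. Qed.

Lemma natr_4d1_neq0 d : (4 * d%:R + 1 : rat) != 0.
Proof. by rewrite -natrM natr1 Num.Theory.pnatr_eq0. Qed.

(** Both sides satisfy f(k+2) = f(k+1) + D f(k) + (D(D+1)/2) M_d(k) with equal initial values. The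
    source term solves the homogeneous recurrence, hence coefficients linear in k; 4D+1 is the
    discriminant of X^2 - X - D. *)
Lemma sum_sumn_codes d k (D := d%:R : rat) (x := k%:R : rat) :
  \sum_(a <- codes d k) (sumn a)%:R =
  (D + 1) / (2 * (4 * D + 1)) *
    ((M d k)%:R * ((2 * D + 1) * x + 1) - (M d k.+1)%:R * (x + 1)).
Proof.
have w0 : 4 * D + 1 != 0 := natr_4d1_neq0 d.
rewrite {}/x; elim/nat_ind2: k => [||k IH0 IH1].
- by rewrite /= big_seq1 /M /=; field.
- by rewrite /= big_seq1 /M /= /D; field.
rewrite (sum_codesSS xpredT) IH1.
(* The bound [m] is separated from [d] to allow induction on it with [codes d k] fixed. *)
have sumE m : \sum_(v <- iota 1 m) \sum_(a <- codes d k) (sumn [:: v, 0%N & a])%:R =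
   m%:R * \sum_(a <- codes d k) (sumn a)%:R + m%:R * (m%:R + 1) / 2 * (M d k)%:R :> rat.
  elim: m => [|m IH].
    by rewrite big_nil !mul0r addr0.
  rewrite iota1S big_rcons /= IH.
  have -> : \sum_(a <- codes d k) (m.+1 + (0 + sumn a))%:R =
    m.+1%:R * (M d k)%:R + \sum_(a <- codes d k) (sumn a)%:R :> rat.
    rewrite -sum_codes1 mulr_sumr -big_split; apply: eq_bigr => a _.
    by rewrite natrD mulr1.
  by rewrite -natr1; field.
rewrite sumE IH0 !M_SS -/D -!natr1.
by field.
Qed.

(** The coefficients are the sums of v and of 'C(v, 2) for v up to [m]. The case m = d drives the
    recurrence in k; m = d-1 treats the bounded head in the final sum. *)
Lemma sum_core_size_cons n d k m :
  \sum_(v <- iota 1 m) \sum_(a <- codes d k) core_size n [:: v, 0%N & a] =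
  m%:R * \sum_(a <- codes d k) core_size n a
  + (m%:R * (m%:R + 1) / 2 * k.+1%:R
     + (n%:R - 1) * ((m%:R - 1) * m%:R * (m%:R + 1) / 6)) * (M d k)%:R
  - m%:R * (m%:R + 1) / 2 * \sum_(a <- codes d k) (sumn a)%:R.
Proof.
elim: m => [|m IH]; first by rewrite big_nil; ring.
rewrite iota1S big_rcons /= IH.
have -> : \sum_(a <- codes d k) core_size n [:: m.+1, 0%N & a] =
  \sum_(a <- codes d k) core_size n a
  + (m.+1%:R * k.+1%:R + (n%:R - 1) * (m.+1%:R * (m.+1%:R - 1) / 2)) * (M d k)%:R
  - m.+1%:R * \sum_(a <- codes d k) (sumn a)%:R.
  rewrite -sum_codes1 !mulr_sumr -big_split -sumrB /=.
  rewrite big_seq [RHS]big_seq; apply: eq_bigr => a.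
  rewrite mem_codes => /andP[/eqP <- _]; rewrite core_size_cons; ring.
by rewrite -!natr1; field.
Qed.

(** The source term now involves [sum_sumn_codes], so the coefficients become quadratic in k. The
    constants [a0] and [- a0] cancel at k = 0, where M_d(0) = M_d(1) = 1 and the sum is 0. *)
Lemma sum_core_size_codes n d k (D := d%:R : rat) (N := n%:R : rat)
    (x := k%:R : rat) (w := 4 * D + 1)
    (a0 := 3 * D * (D + 1) ^+ 2 / (4 * w ^+ 2) + (N - 1) * (D ^+ 2 - 1) / (6 * w)) :
  \sum_(a <- codes d k) core_size n a =
  (M d k)%:R *
    ((D + 1) * (- D ^+ 2 + 2 * D + 1) / (8 * w) * x ^+ 2
     + ((D + 1) * (8 * D ^+ 3 + 9 * D ^+ 2 + 8 * D + 1) / (8 * w ^+ 2)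
        + (N - 1) * (D ^+ 2 - 1) * (2 * D + 1) / (6 * w)) * x
     + a0)
  + (M d k.+1)%:R *
    ((D ^+ 2 - 1) / (8 * w) * x ^+ 2
     - ((D + 1) * (2 * D ^+ 2 + 9 * D + 1) / (8 * w ^+ 2)
        + (N - 1) * (D ^+ 2 - 1) / (6 * w)) * x
     - a0).
Proof.
have w0 : w != 0 := natr_4d1_neq0 d.
rewrite {}/x {}/a0; move: w0; rewrite {}/w => w0; elim/nat_ind2: k => [||k IH0 IH1].
- by rewrite /= big_seq1 /M /core_size /= natr_bin2; field.
- by rewrite /= big_seq1 /M /core_size /= !natr_bin2 ?muln0 ?mul0n /D; field.
rewrite (sum_codesSS xpredT) sum_core_size_cons sum_sumn_codes.
rewrite (eq_bigr _ (fun a _ => core_size0 n a)) IH1 IH0 !M_SS -/D -/N -!natr1.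
by field.
Qed.

(** * Evaluation of the sum over cores *)

Unset Implicit Arguments.

Theorem theorem1p11 (d n : nat) (d_ge1 : (1 <= d)%N) (n_ge2 : (2 <= n)%N) :
  let C := distinct_cores n (d * n - 1)%N in
  let D : rat := d%:R in
  let N : rat := n%:R in
  finite_set C /\
  \sum_(l \in C) ((sumn l)%:R : rat) =
    (M d n)%:R *
      ((D ^+ 2 - 1) * (5 * D ^+ 2 + D - 1) * N ^+ 2 / (24 * D * (4 * D + 1))
       - (D + 1) * (8 * D ^+ 4 + 27 * D ^+ 3 + 2 * D ^+ 2 - 1) * N
           / (24 * D * (4 * D + 1) ^+ 2)
       + (D ^+ 2 - 1) / (12 * D))
    + (M d (n - 1)%N)%:R *
      ((D + 1) * (- D ^+ 3 + 7 * D ^+ 2 + D - 1) * N ^+ 2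
           / (24 * D * (4 * D + 1))
       - (D + 1) * (6 * D ^+ 4 - 19 * D ^+ 3 - 7 * D ^+ 2 + D + 1) * N
           / (24 * D * (4 * D + 1) ^+ 2)
       - (D + 1) * (D ^+ 4 + 20 * D ^+ 3 - 6 * D ^+ 2 - 8 * D - 1)
           / (12 * D * (4 * D + 1) ^+ 2)).
Proof.
move=> C D N; have n_gt0 := ltnW n_ge2.
have CE : C = _ := distinct_cores_codes d_ge1 n_ge2.
split; first by rewrite CE; exact: finite_seq.
rewrite CE -fsbig_seq ?core_codes_uniq // big_map.
have -> : \sum_(a <- core_codes d n) (sumn (code_core n a))%:R =
    \sum_(a <- codes d n | (head 0 a < d)%N) core_size n a :> rat.
  rewrite -[RHS]big_filter big_seq [RHS]big_seq; apply: eq_bigr => a.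
  by move/(sumn_code_core d_ge1 n_gt0) => sE; rewrite /core_size -sE natrD addrK.
have w0 : 4 * D + 1 != 0 := natr_4d1_neq0 d.
have D0 : D != 0 by rewrite Num.Theory.pnatr_eq0 -lt0n.
case: n @N n_ge2 {n_gt0 C CE} => [//|[//|k]] N _.
rewrite (sum_codesSS (fun a => head 0%N a < d)%N) (eq_bigr _ (fun a _ => core_size0 k.+2 a)).
rewrite (eq_bigl xpredT) => [|a]; last by rewrite d_ge1.
(* The bound on the head discards only v = d. *)
have -> : \sum_(v <- iota 1 d) \sum_(a <- codes d k | (v < d)%N)
      core_size k.+2 [:: v, 0%N & a] =
    \sum_(v <- iota 1 d.-1) \sum_(a <- codes d k) core_size k.+2 [:: v, 0%N & a].
  case: d d_ge1 {D w0 D0} => // d _; rewrite iota1S big_rcons /= ltnn big_pred0_eq addr0.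
  rewrite big_seq [RHS]big_seq; apply: eq_bigr => v.
  by rewrite mem_iota add1n => /andP[_ ->].
have d1 : d.-1%:R = D - 1 by rewrite -subn1 natrB.
(* With n = k+2, everything reduces to a rational identity with M_d(k) and M_d(k+1) as free
   quantities. *)
rewrite sum_core_size_cons sum_sumn_codes !sum_core_size_codes d1.
rewrite subn1 !M_SS /N -/D -[k.+2%:R]natr1 -[k.+1%:R]natr1.
by field; rewrite w0 D0.
Qed.
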